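(* Let $R$ be a commutative ring with $1\neq 0$ and let $I$ be a proper ideal of $R$. Then the following statements are equivalent: (1) $I$ is a 1-absorbing primary ideal of $R$. (2) For any proper ideals $I_1,I_2,I_3$ of $R$, if $I_1I_2I_3\subseteq I$, then either $I_1I_2\subseteq I$ or $I_3\subseteq\sqrt{I}$.
   Context: All rings are commutative with $1\neq 0$. For an ideal $I$ of $R$, $\sqrt{I}=\{r\in R \mid r^{n}\in I \text{ for some integer } n\geq 1\}$. A proper ideal $I$ of $R$ is called a 1-absorbing primary ideal of $R$ if whenever $a,b,c\in R$ are nonunit elements with $abc\in I$, then $ab\in I$ or $c\in\sqrt{I}$. *)

(* Defs.v *)
From mathcomp Require Import all_boot all_algebra boolp.

Set Implicit Arguments.
Unset Strict Implicit.
Unset Printing Implicit Defensive.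

Import GRing.Theory.
Local Open Scope ring_scope.

(* Proper ideals are elements of [idealr R], the library's
   boolean predicates that are additive subgroups, do not contain 1 and absorb
   multiplication. By [boolp], every proper ideal given by a Prop-valued
   predicate is of this form, so quantifying over [idealr R] is quantifying
   over all proper ideals. *)

Section Ideals.

Variable R : comNzRingType.
Implicit Types (I J : {pred R}) (a : R).

(* [GRing.unit] would need an inverse function as part of the structure of R. *)
Definition is_unit a : Prop := exists b : R, a * b = 1.

Definition radical I : {pred R} :=
  [pred r | `[< exists n : nat, (1 <= n)%N /\ r ^+ n \in I >]].

(* All finite sums of products of an element of I and an element of J. *)
Definition ideal_mul I J : {pred R} :=
  [pred r | `[< exists (n : nat) (x y : 'I_n -> R),
      [/\ forall i, x i \in I, forall i, y i \in J
        & r = \sum_(i < n) x i * y i] >]].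

End Ideals.

Definition one_absorbing_primary (R : comNzRingType) (I : idealr R) : Prop :=
  forall a b c : R, ~ is_unit a -> ~ is_unit b -> ~ is_unit c ->
    a * b * c \in I -> a * b \in I \/ c \in radical I.

(* Main.v *)
Require Import Defs.
From HB Require Import structures.
From mathcomp Require Import all_boot all_algebra boolp.

Set Implicit Arguments.
Unset Strict Implicit.
Unset Printing Implicit Defensive.

Import GRing.Theory.
Local Open Scope ring_scope.

(** The two statements translate into each other because nonunits are exactly the elements of proper
    ideals: a proper ideal has no units ([proper_ideal_nunit]), and a nonunit generates a proper
    ideal ([proper_principal_ideal]). From elements to ideals, one element of [I3] outside the
    radical forces every product of an element of [I1] and one of [I2] into [I], and sums of such
    products stay there ([ideal_mul_sub]). From ideals to elements, (a)(b)(c) lies in (abc), hence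
    in [I], and the conclusion is read off at the generators. *)

Definition principal_ideal (R : comNzRingType) (a : R) : {pred R} :=
  [pred r | `[< exists s : R, r = a * s >]].

Lemma principal_idealP (R : comNzRingType) (a r : R) :
  reflect (exists s : R, r = a * s) (r \in principal_ideal a).
Proof. exact: asboolP. Qed.

Lemma mem_principal_ideal (R : comNzRingType) (a : R) :
  a \in principal_ideal a.
Proof. by apply/principal_idealP; exists 1; rewrite mulr1. Qed.

Lemma principal_idealr_closed (R : comNzRingType) (a : R) :
  ~ is_unit a -> idealr_closed (principal_ideal a).
Proof.
move=> a_nunit; split.
- by apply/principal_idealP; exists 0; rewrite mulr0.
- by apply/principal_idealP => -[s as1]; apply: a_nunit; exists s.
- move=> t _ _ /principal_idealP[s ->] /principal_idealP[s' ->].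
  by apply/principal_idealP; exists (t * s + s'); rewrite mulrDr mulrCA.
Qed.

(** The equality of predicates allows a statement about the bundled [J] to be rewritten into one
    about [principal_ideal a]. *)
Lemma proper_principal_ideal (R : comNzRingType) (a : R) :
  ~ is_unit a -> exists J : idealr R, (J : {pred R}) = principal_ideal a.
Proof.
move=> /principal_idealr_closed Jid.
pose zmodJ := GRing.isZmodClosed.Build _ (principal_ideal a)
  (idealr_closedB Jid).
pose properJ := isProperIdeal.Build _ (principal_ideal a)
  (idealr_closed_nontrivial Jid).
pose J : idealr R := HB.pack (principal_ideal a) zmodJ properJ.
by exists J.
Qed.

Lemma proper_ideal_nunit (R : comNzRingType) (J : idealr R) (a : R) :
  a \in J -> ~ is_unit a.
Proof.
by move=> Ja [b ab1]; have := idealMr b Ja; rewrite mulrC ab1 idealr1.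
Qed.

Lemma mem_ideal_mul (R : comNzRingType) (I J : {pred R}) (x y : R) :
  x \in I -> y \in J -> x * y \in ideal_mul I J.
Proof.
move=> Ix Jy; apply/asboolP; exists 1%N, (fun=> x), (fun=> y).
by split=> //; rewrite big_ord1.
Qed.

Lemma ideal_mul_sub (R : comNzRingType) (I J : {pred R}) (K : idealr R) :
  (forall x y, x \in I -> y \in J -> x * y \in K) ->
  {subset ideal_mul I J <= K}.
Proof.
move=> IJK r /asboolP[n [x [y [Ix Jy ->]]]].
by apply: rpred_sum => i _; apply: IJK.
Qed.

Lemma principal_ideal_mul_sub (R : comNzRingType) (a b : R) (I : idealr R) :
  a * b \in I ->
  {subset ideal_mul (principal_ideal a) (principal_ideal b) <= I}.
Proof.
move=> Iab; apply: ideal_mul_sub.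
move=> _ _ /principal_idealP[s ->] /principal_idealP[t ->].
by rewrite mulrACA mulrC idealMr.
Qed.

(** The target may be the whole ring, so [ideal_mul_sub], whose target is proper, does not apply.
    Instead [a * b] is factored out of each summand, with cofactors picked by choice, and then out
    of the sum. *)
Lemma ideal_mul_principal (R : comNzRingType) (a b : R) :
  {subset ideal_mul (principal_ideal a) (principal_ideal b)
     <= principal_ideal (a * b)}.
Proof.
move=> r /asboolP[n [x [y [ax by_ ->]]]].
have /choice[s sE] i : exists s, x i * y i = a * b * s.
  have /principal_idealP[s ->] := ax i; have /principal_idealP[t ->] := by_ i.
  by exists (s * t); rewrite mulrACA.
apply/principal_idealP; exists (\sum_(i < n) s i).
by rewrite mulr_sumr; apply: eq_bigr.
Qed.

Theorem theorem21 (R : comNzRingType) (I : idealr R) :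
  one_absorbing_primary I <->
  (forall I1 I2 I3 : idealr R,
     {subset ideal_mul (ideal_mul I1 I2) I3 <= I} ->
     {subset ideal_mul I1 I2 <= I} \/ {subset I3 <= radical I}).
Proof.
split=> [absI I1 I2 I3 sub | absI a b c na nb nc Iabc].
  (* Classically, either [I3] lies in the radical or some [c] in it does not; this single [c] serves
     all [a] and [b] below. *)
  have [rad|/existsNP[c /not_implyP[I3c radNc]]] :=
    pselect {subset I3 <= radical I}; first by right.
  left; apply: ideal_mul_sub => a b I1a I2b.
  have Iabc : a * b * c \in I by apply: sub; do 2?apply: mem_ideal_mul.
  by case: (absI a b c (proper_ideal_nunit I1a) (proper_ideal_nunit I2b)
    (proper_ideal_nunit I3c) Iabc).
have [J1 J1E] := proper_principal_ideal na.
have [J2 J2E] := proper_principal_ideal nb.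
have [J3 J3E] := proper_principal_ideal nc.
have := absI J1 J2 J3; rewrite J1E J2E J3E => -[|sub|sub].
(* The premise on the triple product: [x] lies in (ab) and [y] in (c), so [x * y] lies in (ab)(c),
   which is inside [I]. *)
- apply: ideal_mul_sub => x y /ideal_mul_principal xab yc.
  by apply: principal_ideal_mul_sub Iabc _ _; apply: mem_ideal_mul.
- by left; apply/sub/mem_ideal_mul; apply: mem_principal_ideal.
- by right; apply/sub/mem_principal_ideal.
Qed.
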